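(* Let $M,N$ be positive integers with $N<M$, let $P=\sum_{j=0}^M\zeta_j\partial_x^j$ with $\zeta_j\in\mathbb R$, $\zeta_M\ne0$, let $v\in\mathbb N$ and $B\in\mathbb R^{v\times M}$. Assume $f=0$, i.e. consider the linear PDE $\partial_t^Ny=Py$. Then the compatibility set $\mathcal C$ is $$\mathcal C=\{Y_0=(y_0,y_1,\dots,y_{N-1})\in C^\infty([0,1])^N:\ (BP^kY^{x,l})(0)=0\ \ \forall k\in\mathbb N,\ \forall l=0,\dots,N-1\},$$ where $Y^{x,l}:=(y_l,\partial_xy_l,\dots,\partial_x^{M-1}y_l)$ and $P^k$ acts componentwise.
   Context: Functions are real-valued. Notation: $Y^x=(y,\partial_xy,\dots,\partial_x^{M-1}y)$, $Y^t=(y,\partial_ty,\dots,\partial_t^{N-1}y)$. The maps $J_l$ (for $f=0$): introduce jet variables $u_{i,k}$, $0\le i\le N-1$, $k\in\mathbb N$ (standing for $\partial_t^i\partial_x^ky$). On smooth functions $G$ of $x\in[-1,1]$ and finitely many jet variables put $D_xG=\partial_xG+\sum_{i,k}u_{i,k+1}\,\partial G/\partial u_{i,k}$ and $D_tG=\sum_{i<N-1,\,k}u_{i+1,k}\,\partial G/\partial u_{i,k}+\sum_k (D_x^kF)\,\partial G/\partial u_{N-1,k}$, where $F=\sum_{j=0}^M\zeta_ju_{0,j}$. Let $J_l=(D_t^lu_{0,0},\dots,D_t^lu_{0,M-1})$. It depends only on the $u_{i,k}$ with $k\le m(l)$ for some $m(l)\in\mathbb N$, and is viewed as a map $[-1,1]\times(\mathbb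 R^N)^{m(l)+1}\to\mathbb R^M$ (the $k$-th $\mathbb R^N$-argument being $(u_{0,k},\dots,u_{N-1,k})$); it satisfies $\partial_t^lY^x=J_l(x,Y^t,\partial_xY^t,\dots,\partial_x^{m(l)}Y^t)$ for every smooth solution of the PDE. Compatibility set: $\mathcal C=\{Y_0\in C^\infty([0,1])^N:\ BJ_l(x,Y_0,\partial_xY_0,\dots,\partial_x^{m(l)}Y_0)|_{x=0}=0\ \ \forall l\in\mathbb N\}$. *)

(* Defs.v *)
From HB Require Import structures.
From mathcomp Require Import all_boot all_order all_algebra.
From mathcomp Require Import all_classical all_reals all_analysis.
Import Order.TTheory GRing.Theory Num.Theory.
Import numFieldNormedType.Exports.

Set Implicit Arguments.
Unset Strict Implicit.
Unset Printing Implicit Defensive.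

Local Open Scope classical_set_scope.
Local Open Scope ring_scope.

Section DerivativeOn.
Context {R : realType}.
Implicit Types (A : set R) (f : R -> R).

Definition slope f (x y : R) : R := (f y - f x) / (y - x).

(* The difference quotients only use points of [A], so the derivative is
   one-sided at an endpoint of an interval and, for x in A, depends only on the
   restriction of [f] to [A]. *)
Definition derive_on A f (x : R) : R := lim (slope f x y @[y --> within A x^']).

Definition derivable_on A f (x : R) : Prop :=
  cvg (slope f x y @[y --> within A x^']).

Definition deriven_on A (n : nat) f : R -> R := iter n (derive_on A) f.

(* An element of C^oo(A) is represented by any function R -> R extending it;
   the values outside [A] are irrelevant. *)
Definition smooth_on A f : Prop :=
  forall n x, A x -> derivable_on A (deriven_on A n f) x.

End DerivativeOn.

Section Jets.
Context {R : realType} {N : nat}.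

(* [u i k] is the jet variable u_{i,k}, standing for \partial_t^i \partial_x^k y. *)
Definition jet := 'I_N -> nat -> R.

(* Functions of x in [-1, 1] and the jet variables. *)
Definition jet_fun := R -> jet -> R.

Definition jet_var (i : 'I_N) (k : nat) : jet_fun := fun _ u => u i k.

Definition jet_upd (u : jet) (i : 'I_N) (k : nat) (s : R) : jet :=
  fun j l => if (j == i) && (l == k) then s else u j l.

Definition jet_du (i : 'I_N) (k : nat) (G : jet_fun) : jet_fun :=
  fun x u => derive1 (fun s : R => G x (jet_upd u i k s)) (u i k).

Definition jet_dx (G : jet_fun) : jet_fun :=
  fun x u => derive_on `[-1, 1] (fun s => G s u) x.

(* The sums over k : nat are finitely supported sums: if G depends on finitely
   many jet variables, all but finitely many terms vanish. *)
Definition Dx (G : jet_fun) : jet_fun := fun x u =>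
  jet_dx G x u +
  \sum_(i < N) \sum_(k \in [set: nat]) u i k.+1 * jet_du i k G x u.

(* \partial_t u_{i,k} along the PDE \partial_t^N y = F: it is u_{i+1,k} if
   i < N - 1 and D_x^k F if i = N - 1. *)
Definition jet_dt (F : jet_fun) (i : 'I_N) (k : nat) : jet_fun :=
  if insub i.+1 is Some i' then jet_var i' k else iter k Dx F.

Definition Dt (F G : jet_fun) : jet_fun := fun x u =>
  \sum_(i < N) \sum_(k \in [set: nat]) jet_dt F i k x u * jet_du i k G x u.

End Jets.
Arguments jet : clear implicits.
Arguments jet_fun : clear implicits.

Section Compatibility.
Context {R : realType} {N M v : nat}.
Implicit Types (zeta : 'I_M.+1 -> R) (B : 'M[R]_(v, M)) (Y : 'I_N -> R -> R).

Definition pde_rhs (N_gt0 : (0 < N)%N) zeta : jet_fun R N :=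
  fun _ u => \sum_(j < M.+1) zeta j * u (Ordinal N_gt0) j.

(* J_l, as a function on the space of infinite jets; it depends on finitely
   many of the u_{i,k}. *)
Definition J (N_gt0 : (0 < N)%N) zeta (l : nat) (x : R) (u : jet R N) :
    'cV[R]_M :=
  \col_(j < M)
    iter l (Dt (pde_rhs N_gt0 zeta)) (jet_var (Ordinal N_gt0) j) x u.

Definition jet_of Y (x : R) : jet R N :=
  fun i k => deriven_on `[0, 1] k (Y i) x.

Definition compatibility_set (N_gt0 : (0 < N)%N) zeta B :
    set ('I_N -> R -> R) :=
  [set Y | (forall i, smooth_on `[0, 1] (Y i)) /\
           forall l : nat, B *m J N_gt0 zeta l 0 (jet_of Y 0) = 0].

(* P = \sum_j zeta_j \partial_x^j, acting on C^oo([0, 1]). *)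
Definition diff_op zeta (g : R -> R) : R -> R :=
  fun x => \sum_(j < M.+1) zeta j * deriven_on `[0, 1] j g x.

End Compatibility.

(* Main.v *)
Require Import Defs.
From HB Require Import structures.
From mathcomp Require Import all_boot all_order all_algebra.
From mathcomp Require Import all_classical all_reals all_analysis.
From mathcomp Require Import zify.
Import Order.TTheory GRing.Theory Num.Theory.
Import numFieldNormedType.Exports.

(** Since F is linear in the jet variables and has constant coefficients, every
    function produced by iterating D_x and D_t is again linear in the jets, and
    can be recorded by its symbol: a polynomial p stands for the jet function
    \sum_k p_k u_{i,k} with i fixed (that is, p(\partial_x) applied to
    \partial_t^i y).  On symbols D_x is multiplication by 'X, and D_t replaces i
    by i + 1 while i < N - 1, whereas for i = N - 1 it returns to i = 0 and
    multiplies the symbol by Z = \sum_j zeta_j 'X^j, the symbol of P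
    ([Dt_jet_pol_succ], [Dt_jet_pol_last]).  Hence D_t^{kN+i} u_{0,j} has row i
    and symbol Z^k 'X^j ([iter_Dt]).

    On the other side, for y smooth on [0, 1], P^k \partial_x^j y is
    Z^k 'X^j with 'X^m read as \partial_x^m y ([iter_diff_op]).  So J_{kN+i} at
    the jet of Y at 0 is exactly (P^k Y^{x,i})(0), and as (k, i) ranges over nat x 'I_N the
    number kN + i ranges over all of nat: the two families of boundary
    conditions are the same family, indexed differently.

    Derivatives are limits of difference quotients within an interval, and such
    limits are meaningful only at points of the interval; the identities are
    therefore propagated along the iterations only on the interval. *)

Set Implicit Arguments.
Unset Strict Implicit.
Unset Printing Implicit Defensive.

Local Open Scope classical_set_scope.
Local Open Scope ring_scope.

(** * Polynomials as finitely supported linear forms on sequences *)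

Section Umbral.
Context {R : realType}.
Implicit Types (w : nat -> R) (p q : {poly R}).

(** The linear form on polynomials sending 'X^k to w k.  With w k the k-th
    derivative of y, it is p(\partial_x) y. *)
Definition umbral w p : R := \sum_(k < size p) p`_k * w k.

Lemma umbral_wide w p n : (size p <= n)%N ->
  umbral w p = \sum_(k < n) p`_k * w k.
Proof.
move=> pn; rewrite /umbral (big_ord_widen n (fun k => p`_k * w k) pn).
rewrite big_mkcond /=; apply: eq_bigr => k _; case: ltnP => // pk.
by rewrite nth_default ?mul0r.
Qed.

Lemma umbral_is_linear w : linear_for *%R (umbral w).
Proof.
move=> a p q; set n := maxn (size p) (size q).
have pn : (size p <= n)%N by rewrite leq_maxl.
have qn : (size q <= n)%N by rewrite leq_maxr.
have apqn : (size (a *: p + q)%R <= n)%N.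
  rewrite (leq_trans (size_polyD _ _))// geq_max qn andbT.
  exact: leq_trans (size_scale_leq _ _) pn.
rewrite (umbral_wide _ pn) (umbral_wide _ qn) (umbral_wide _ apqn).
rewrite big_distrr -big_split /=; apply: eq_bigr => k _.
by rewrite coefD coefZ mulrDl mulrA.
Qed.

HB.instance Definition _ w :=
  GRing.isLinear.Build R {poly R} R *%R (umbral w) (umbral_is_linear w).

Lemma umbralXn w k : umbral w 'X^k = w k.
Proof.
rewrite /umbral size_polyXn big_ord_recr /= coefXn eqxx mul1r big1 ?add0r//.
by move=> i _; rewrite coefXn ltn_eqF ?mul0r.
Qed.

(** Evaluating twice is multiplying symbols: by linearity it is enough to look
    at q = 'X^j.  This is the only algebra behind both sides of the theorem. *)
Lemma umbralM w p q : umbral (fun j => umbral w ('X^j * p)) q = umbral w (q * p).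
Proof.
rewrite -[in RHS](coefK q) poly_def mulr_suml linear_sum.
by apply: eq_bigr => j _; rewrite -scalerAl linearZ.
Qed.

Lemma umbralMX w p : umbral w ('X * p) = umbral (fun k => w k.+1) p.
Proof.
rewrite mulrC -umbralM; apply: eq_bigr => k _.
by rewrite -exprSr umbralXn.
Qed.

End Umbral.

(** * Derivatives relative to a segment *)

Section DeriveOnSegment.
Context {R : realType} {a b : R} (ltab : a < b).
Implicit Types (f g : R -> R) (x : R).
Local Notation A := `[a, b]%classic.

(** A point of a nondegenerate segment is an accumulation point of it, from the
    right or from the left; this is what makes limits along [within A x^']
    unique. *)
Lemma within_segment_proper x : A x -> ProperFilter (within A x^').
Proof.
move=> Ax; apply: Build_ProperFilter => H.
have {}H : \forall y \near x, y != x -> A y -> False by exact: H.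
move: Ax; rewrite /= in_itv /= => /andP[ax xb].
have [xltb|blex] := ltP x b.
- suff /filter_ex[] : \forall y \near x^'+, False by [].
  have Hr : \forall y \near x^'+, y != x -> A y -> False.
    by rewrite near_withinE; apply: filterS H => y H _; exact: H.
  near=> y; suff Ay : A y.
    have : y != x -> A y -> False by near: y.
    by apply => //; near: y; exact: nbhs_right_neq.
  rewrite /= in_itv /=; apply/andP; split.
    by apply: (le_trans ax); near: y; exact: nbhs_right_ge.
  by near: y; exact: nbhs_right_ltW.
- suff /filter_ex[] : \forall y \near x^'-, False by [].
  have Hl : \forall y \near x^'-, y != x -> A y -> False.
    by rewrite near_withinE; apply: filterS H => y H _; exact: H.
  near=> y; suff Ay : A y.
    have : y != x -> A y -> False by near: y.
    by apply => //; near: y; exact: nbhs_left_neq.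
  rewrite /= in_itv /=; apply/andP; split.
    by near: y; apply: nbhs_left_ge; exact: lt_le_trans blex.
  by rewrite (le_trans _ xb)//; near: y; exact: nbhs_left_le.
Unshelve. all: by end_near. Qed.

Lemma derive_onE f x l : A x ->
  slope f x y @[y --> within A x^'] --> l -> derive_on A f x = l.
Proof.
by move=> /within_segment_proper ? /cvg_lim; apply; exact: Rhausdorff.
Qed.

Lemma derive_on_cst c x : A x -> derive_on A (fun=> c) x = 0.
Proof.
move=> Ax; apply: derive_onE => //; rewrite /slope subrr.
under eq_fun do rewrite mul0r; exact: cvg_cst.
Qed.

(** The difference quotients along [within A x^'] see f only on A. *)
Lemma eq_derive_on f g x : {in A, f =1 g} -> A x ->
  derive_on A f x = derive_on A g x.
Proof.
move=> fg Ax; rewrite /derive_on.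
suff -> : slope f x y @[y --> within A x^'] = slope g x y @[y --> within A x^'].
  by [].
have e h h' : {in A, h =1 h'} -> {near within A x^', slope h x =1 slope h' x}.
  move=> hh'; apply: filterS (@withinT _ x^' A _) => y Ay.
  by rewrite /slope !hh' ?inE.
by apply/seteqP; split; apply: near_eq_cvg; apply: e => // y /fg.
Qed.

Lemma eq_deriven_on f g k : {in A, f =1 g} ->
  {in A, deriven_on A k f =1 deriven_on A k g}.
Proof.
move=> fg; elim: k => [|k IH]//= x; rewrite inE => Ax.
exact: eq_derive_on.
Qed.

(** p(\partial_x) f, differentiated m times, has symbol 'X^m * p: each term can
    be differentiated because f is smooth. *)
Lemma deriven_on_umbral f p m x : smooth_on A f -> A x ->
  deriven_on A m (fun y => umbral (fun k => deriven_on A k f y) p) x =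
  umbral (fun k => deriven_on A k f x) ('X^m * p).
Proof.
move=> sf; elim: m x => [|m IH] x Ax; first by rewrite expr0 mul1r.
rewrite /deriven_on iterS -/(deriven_on _ _ _).
rewrite (@eq_derive_on _
  (fun y => umbral (fun k => deriven_on A k f y) ('X^m * p)))//.
  apply: derive_onE => //; rewrite exprS -mulrA umbralMX; set q := 'X^m * p.
  have -> : slope (fun y => umbral (fun k => deriven_on A k f y) q) x =
            fun y => umbral (fun k => slope (deriven_on A k f) x y) q.
    apply/funext => y; rewrite /slope /umbral -sumrB mulr_suml.
    by apply: eq_bigr => k _; rewrite -mulrBr mulrA.
  apply: cvg_big => [|k _]; first exact: add_continuous.
  by apply: cvgMr; exact: sf.
by move=> y; rewrite inE => /IH.
Qed.

End DeriveOnSegment.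

(** * Total derivatives of linear jet functions *)

Section JetPol.
Context {R : realType} {N : nat}.
Implicit Types (G H : jet_fun R N) (u : jet R N) (p : {poly R}).
Local Notation A := `[-1, 1]%classic.

Definition jet_pol (i : 'I_N) p : jet_fun R N := fun _ u => umbral (u i) p.

Lemma jet_varE i k : jet_var i k = jet_pol i 'X^k.
Proof. by apply/funext => x; apply/funext => u; rewrite /jet_pol umbralXn. Qed.

Lemma eq_jet_du i k G H x u : G x = H x -> jet_du i k G x u = jet_du i k H x u.
Proof. by rewrite /jet_du => ->. Qed.

Lemma umbral_upd (w : nat -> R) k s p :
  umbral (fun l => if l == k then s else w l) p =
  umbral (fun l => if l == k then 0 else w l) p + p`_k * s.
Proof.
have -> : p`_k * s = \sum_(l < size p | l == k :> nat) p`_l * s.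
  rewrite (big_ord1_eq _ (fun l => p`_l * s)).
  by case: ltnP => // pk; rewrite nth_default ?mul0r.
rewrite big_mkcond -big_split; apply: eq_bigr => l _ /=.
by case: eqP => _; rewrite ?mulr0 ?add0r ?addr0.
Qed.

(** A linear jet function is affine in each u_{i,k}, with slope its
    coefficient. *)
Lemma jet_du_jet_pol i i' k p x u :
  jet_du i' k (jet_pol i p) x u = if i == i' then p`_k else 0.
Proof.
rewrite /jet_du /jet_pol /jet_upd; have [->|_] := eqVneq i i'; last first.
  by under eq_fun do rewrite /=; exact: derive1_cst.
under eq_fun do rewrite /= umbral_upd.
set c := umbral _ _; rewrite derive1E.
have -> : (fun s : R => c + p`_k * s) = cst c + p`_k \*: id by [].
by rewrite derive_val add0r /GRing.scale /= mulr1.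
Qed.

Lemma sum_jet_du_jet_pol (c : 'I_N -> nat -> R) i p x u :
  \sum_(i' < N) \sum_(k \in [set: nat]) c i' k * jet_du i' k (jet_pol i p) x u =
  umbral (c i) p.
Proof.
rewrite (bigD1 i)//= [X in _ + X]big1 ?addr0 => [|i' i'i]; last first.
  apply: fsbig1 => k _.
  by rewrite jet_du_jet_pol eq_sym (negPf i'i) mulr0.
rewrite -(fsbig_widen `I_(size p)) => [||k [_ /= /negP]]//; last first.
  by rewrite -leqNgt => pk; rewrite jet_du_jet_pol eqxx nth_default ?mulr0.
rewrite -fsbig_ord; apply: eq_bigr => k _.
by rewrite jet_du_jet_pol eqxx mulrC.
Qed.

Let ltN11 : -1 < 1 :> R. Proof. exact: lt_trans (ltrN10 R) ltr01. Qed.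

Lemma eq_Dx G H : {in A, G =1 H} -> {in A, Dx G =1 Dx H}.
Proof.
move=> GH x xA; apply/funext => u; rewrite /Dx; congr (_ + _).
  apply: eq_derive_on; last by rewrite inE in xA.
  by move=> y /GH ->.
apply: eq_bigr => i _; apply: eq_fsbigr => k _.
by rewrite (eq_jet_du _ _ _ (GH x xA)).
Qed.

Lemma Dx_jet_pol i p : {in A, Dx (jet_pol i p) =1 jet_pol i ('X * p)}.
Proof.
move=> x; rewrite inE => Ax; apply/funext => u.
rewrite /Dx sum_jet_du_jet_pol [jet_dx _ _ _]derive_on_cst// ?add0r.
by rewrite /jet_pol umbralMX.
Qed.

Lemma iter_Dx k i p :
  {in A, iter k Dx (jet_pol i p) =1 jet_pol i ('X^k * p)}.
Proof.
elim: k => [|k IH] x xA; first by rewrite expr0 mul1r.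
by rewrite iterS (eq_Dx IH)// Dx_jet_pol// exprS mulrA.
Qed.

Lemma eq_Dt F G H x : G x = H x -> Dt F G x = Dt F H x.
Proof.
move=> GH; apply/funext => u.
by apply: eq_bigr => i _; apply: eq_fsbigr => k _; rewrite (eq_jet_du _ _ _ GH).
Qed.

Lemma Dt_jet_pol_succ F (i i' : 'I_N) p x :
  i' = i.+1 :> nat -> Dt F (jet_pol i p) x = jet_pol i' p x.
Proof.
move=> i'E; apply/funext => u.
by rewrite /Dt sum_jet_du_jet_pol /jet_dt -i'E valK.
Qed.

(** In the last row the PDE is substituted: \partial_x^k \partial_t^N y becomes
    D_x^k F, of symbol 'X^k * q, so [umbralM] composes the symbols. *)
Lemma Dt_jet_pol_last (i i0 : 'I_N) p q x : i.+1 = N -> A x ->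
  Dt (jet_pol i0 q) (jet_pol i p) x = jet_pol i0 (p * q) x.
Proof.
move=> iN Ax; apply/funext => u.
rewrite /Dt sum_jet_du_jet_pol /jet_dt insubF ?iN ?ltnn//.
rewrite /jet_pol -umbralM; apply: eq_bigr => k _; congr (_ * _).
by rewrite iter_Dx ?inE.
Qed.

End JetPol.

(** * The two iterations and their comparison *)

Section Comparison.
Context {R : realType} {M N : nat} (N_gt0 : (0 < N)%N) (zeta : 'I_M.+1 -> R).

Definition symbolP : {poly R} := \poly_(j < M.+1) zeta (inord j).

Lemma umbral_symbolP w : umbral w symbolP = \sum_(j < M.+1) zeta j * w j.
Proof.
rewrite (umbral_wide _ (size_poly _ _)); apply: eq_bigr => j _.
by rewrite coef_poly ltn_ord inord_val.
Qed.

Lemma pde_rhsE : pde_rhs N_gt0 zeta = jet_pol (Ordinal N_gt0) symbolP.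
Proof.
by apply/funext => x; apply/funext => u; rewrite /jet_pol umbral_symbolP.
Qed.

Lemma iter_Dt k (i : 'I_N) j x : `[-1, 1]%classic x ->
  iter (k * N + i) (Dt (pde_rhs N_gt0 zeta)) (jet_var (Ordinal N_gt0) j) x =
  jet_pol i (symbolP ^+ k * 'X^j) x.
Proof.
move=> Ax; rewrite pde_rhsE jet_varE.
have [l lE] : {l | l = (k * N + i)%N} by exists (k * N + i)%N.
rewrite -lE; elim: l k i lE => [|l IH] k [i iN] /= lE.
  have i0 : i = 0%N by lia.
  have k0 : k = 0%N by nia.
  by subst; rewrite expr0 mul1r; congr jet_pol; apply: val_inj.
case: i iN lE => [|i] iN lE.
- (* row 0 is reached from the last row of the previous block *)
  case: k lE => [|k] lE; first by lia.
  have Np : (N.-1 < N)%N by lia.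
  rewrite (eq_Dt _ (IH k (Ordinal Np) _)) /=; last by nia.
  rewrite Dt_jet_pol_last//=; last by lia.
  rewrite mulrC mulrA -exprS; congr (jet_pol _ _ x); exact: val_inj.
- have iN' : (i < N)%N by lia.
  rewrite (eq_Dt _ (IH k (Ordinal iN') _)) /=; last by lia.
  exact: Dt_jet_pol_succ.
Qed.

Lemma diff_opE g x :
  diff_op zeta g x = umbral (fun m => deriven_on `[0, 1] m g x) symbolP.
Proof. by rewrite umbral_symbolP. Qed.

Lemma iter_diff_op f k j x : smooth_on `[0, 1] f -> `[0, 1]%classic x ->
  iter k (diff_op zeta) (deriven_on `[0, 1] j f) x =
  umbral (fun m => deriven_on `[0, 1] m f x) (symbolP ^+ k * 'X^j).
Proof.
move=> sf; elim: k x => [|k IH] x Ax; first by rewrite expr0 mul1r umbralXn.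
rewrite iterS diff_opE exprS -mulrA -umbralM.
apply: eq_bigr => m _; congr (_ * _).
rewrite -deriven_on_umbral ?ltr01//.
apply: eq_deriven_on; last by rewrite inE.
by move=> y; rewrite inE => /IH.
Qed.

Lemma J_jet_of Y k (i : 'I_N) : (forall i, smooth_on `[0, 1] (Y i)) ->
  J N_gt0 zeta (k * N + i) 0 (jet_of Y 0) =
  \col_(j < M) iter k (diff_op zeta) (deriven_on `[0, 1] j (Y i)) 0.
Proof.
move=> sY; apply/colP => j; rewrite !mxE iter_Dt; last first.
  by rewrite /= in_itv /= lerN10 ler01.
by rewrite iter_diff_op // /= in_itv /= lexx ler01.
Qed.

End Comparison.

Theorem proposition2p8 (R : realType) (M N : nat) (M_gt0 : (0 < M)%N)
    (N_gt0 : (0 < N)%N) (ltNM : (N < M)%N)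
    (zeta : 'I_M.+1 -> R) (zetaM_neq0 : zeta ord_max != 0)
    (v : nat) (B : 'M[R]_(v, M)) :
  compatibility_set N_gt0 zeta B =
  [set Y : 'I_N -> R -> R |
    (forall i : 'I_N, smooth_on `[0, 1] (Y i)) /\
    forall (k : nat) (l : 'I_N),
      B *m (\col_(j < M)
              iter k (diff_op zeta) (deriven_on `[0, 1] j (Y l)) 0) = 0].
Proof.
apply/seteqP; split => Y /= [sY BY]; split=> //.
  by move=> k i; rewrite -(J_jet_of N_gt0).
move=> l; have lN : (l %% N < N)%N by rewrite ltn_pmod.
by rewrite (divn_eq l N) (J_jet_of N_gt0 _ _ (Ordinal lN) sY) BY.
Qed.
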